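(* Let $X$ and $Y$ be quasi-Banach spaces with respective unconditional bases $\mathcal{B}_x$ and $\mathcal{B}_y$. Suppose that the pair $(\mathcal{B}_x,\mathcal{B}_y)$ is lattice-estimate disjoint, i.e. there is $q\in(0,\infty]$ such that $\mathcal{B}_x$ satisfies a lower $q$-estimate, $\mathcal{B}_y$ satisfies an upper $q$-estimate, and at least one of $X$, $Y$ contains no subspace isomorphic to $\ell_q$ (with $\ell_\infty$ replaced by $c_0$ if $q=\infty$). Then every bounded linear operator from $Y$ into $X$ is compact.
   Context: An unconditional basis $\mathcal{B}$ of a quasi-Banach space $X$ satisfies an upper (resp. lower) $q$-estimate, $0<q\le\infty$, if there is a constant $C$ such that for every finite family $(f_i)_{i\in F}$ in $X$ of vectors with pairwise disjoint supports with respect to $\mathcal{B}$ one has $\|\sum_{i\in F} f_i\|\le C\big(\sum_{i\in F}\|f_i\|^q\big)^{1/q}$ (resp. $\big(\sum_{i\in F}\|f_i\|^q\big)^{1/q}\le C\|\sum_{i\in F} f_i\|$), with $\max_{i\in F}\|f_i\|$ in place of $(\sum\|f_i\|^q)^{1/q}$ if $q=\infty$. *)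

(* Defs.v *)
From HB Require Import structures.
From mathcomp Require Import all_boot all_order all_algebra.
From mathcomp Require Import finmap complex.
From mathcomp Require Import all_classical all_reals all_analysis.
From mathcomp.analysis.showcase Require Import summability.

Set Implicit Arguments.
Unset Strict Implicit.
Unset Printing Implicit Defensive.

Import Order.TTheory GRing.Theory Num.Theory numFieldNormedType.Exports.

Local Open Scope classical_set_scope.
Local Open Scope ring_scope.

Variant scalar_kind := RealScalars | ComplexScalars.

Definition scalar_field (R : realType) (k : scalar_kind) : numFieldType :=
  match k with
  | RealScalars => R
  | ComplexScalars => R[i]
  end.

(* The norm of a [numFieldType] is valued in the field itself; estimates such
   as [\sum_i modulus (a i) `^ r] need it valued in [R]. *)
Definition modulus (R : realType) (k : scalar_kind) : scalar_field R k -> R :=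
  match k with
  | RealScalars => fun a : R => `|a|
  | ComplexScalars => fun a : R[i] => Normc.normc a
  end.

(* A quasi-norm satisfies the triangle inequality only up to a multiplicative
   constant. Its balls need not be open, but the relations
   [qnorm (u - v) < e] form a base of a uniformity, and this is required to be
   the uniformity of the space, so that convergence, [cauchy], [closure] and
   [compact] refer to the quasi-norm. Completeness is a field because joining
   [Complete], which is pointed, with [GRing.Lmodule] is not possible on top of
   the existing hierarchy. *)
HB.mixin Record PreUniformLmodule_isQuasiBanach (R : realType)
    (k : scalar_kind) V & PreUniformLmodule (scalar_field R k) V := {
  qnorm : V -> R ;
  qnorm_ge0 : forall v, 0 <= qnorm v ;
  qnorm_eq0 : forall v, qnorm v = 0 -> v = 0 ;
  qnormZ : forall (a : scalar_field R k) v,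
    qnorm (a *: v) = modulus a * qnorm v ;
  ler_qnormD : exists kappa : R,
    forall u v, qnorm (u + v) <= kappa * (qnorm u + qnorm v) ;
  entourage_qnormE : @entourage V =
    filter_from [set e : R | 0 < e]
      (fun e => [set uv : V * V | qnorm (uv.1 - uv.2) < e]) ;
  qnorm_complete : forall F : set_system V,
    ProperFilter F -> cauchy F -> exists v : V, F --> v
}.

#[short(type="quasiBanachType")]
HB.structure Definition QuasiBanach (R : realType) (k : scalar_kind) :=
  {V of PreUniformLmodule (scalar_field R k) V
      & PreUniformLmodule_isQuasiBanach R k V}.

Section Bases.
Context {R : realType} {k : scalar_kind} {X : quasiBanachType R k}.
Context {I : countType}.
Implicit Types (x : I -> X) (f : X) (q : \bar R).

(* [f = \sum_i a i *: x i] with unconditional convergence, that is, along the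
   net of finite subsets of [I]. *)
Definition expands x (a : I -> scalar_field R k) f :=
  partial_sum (fun i => a i *: x i) @ totally --> f.

Definition unconditional_basis x := forall f, exists! a, expands x a f.

Definition bsupport x f : set I :=
  [set i | exists2 a, expands x a f & a i != 0].

Definition disjointly_supported x n (f : 'I_n -> X) :=
  trivIset setT (fun j => bsupport x (f j)).

(* [q] is meant to range over [0 < q <= +oo]; the value at [-oo] is junk. *)
Definition lsum q n (t : 'I_n -> R) : R :=
  if q is r%:E then (\sum_(j < n) t j `^ r) `^ r^-1
  else \big[Num.max/0]_(j < n) t j.

Definition upper_estimate x q := exists C : R,
  forall n (f : 'I_n -> X), disjointly_supported x f ->
    qnorm (\sum_(j < n) f j) <= C * lsum q (fun j => qnorm (f j)).

Definition lower_estimate x q := exists C : R,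
  forall n (f : 'I_n -> X), disjointly_supported x f ->
    lsum q (fun j => qnorm (f j)) <= C * qnorm (\sum_(j < n) f j).

End Bases.

Section SequenceSpaces.
Context {R : realType} {k : scalar_kind}.
Implicit Types (q : \bar R) (a : nat -> scalar_field R k).

(* [ell_q] for finite [q], and [c_0] (not [ell_oo]) for [q = +oo]. *)
Definition ell q : set (nat -> scalar_field R k) :=
  if q is r%:E then
    [set a : nat -> scalar_field R k |
      (\sum_(0 <= n <oo) (modulus (a n) `^ r)%:E < +oo)%E]
  else [set a : nat -> scalar_field R k | modulus (a n) @[n --> \oo] --> 0].

Definition ell_norm q a : R :=
  if q is r%:E then
    fine (\sum_(0 <= n <oo) (modulus (a n) `^ r)%:E)%E `^ r^-1
  else sup (range (fun n => modulus (a n))).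

(* [S] is an isomorphism of [ell q] onto a subspace of [X]; its values outside
   of [ell q] are irrelevant. *)
Definition contains_ell (X : quasiBanachType R k) q :=
  exists S : (nat -> scalar_field R k) -> X,
    (forall (c : scalar_field R k) a b, ell q a -> ell q b ->
       S (fun n => c * a n + b n) = c *: S a + S b) /\
    (exists c C : R, 0 < c /\ forall a, ell q a ->
       c * ell_norm q a <= qnorm (S a) <= C * ell_norm q a).

End SequenceSpaces.

Definition lattice_estimate_disjoint (R : realType) (k : scalar_kind)
    (X Y : quasiBanachType R k) (I J : countType)
    (x : I -> X) (y : J -> Y) :=
  exists2 q : \bar R, (0 < q)%E &
    [/\ lower_estimate x q, upper_estimate y q &
        ~ contains_ell X q \/ ~ contains_ell Y q].

Section Operators.
Context {R : realType} {k : scalar_kind} {Y X : quasiBanachType R k}.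

Definition bounded_operator (T : Y -> X) :=
  exists C : R, forall v, qnorm (T v) <= C * qnorm v.

Definition compact_operator (T : Y -> X) :=
  precompact (T @` [set v | qnorm v <= 1]).

End Operators.

(* Main.v *)
Require Import Defs.
From mathcomp Require Import all_boot all_order all_algebra.
From mathcomp Require Import finmap complex.
From mathcomp Require Import all_classical all_reals all_analysis.
From mathcomp Require Import ring lra.
From mathcomp.analysis.showcase Require Import summability.

(** Assume that [T : Y -> X] is bounded but not compact. The claim is that both
    [Y] and [X] then contain [ell q], against the last clause of the hypothesis.

    The heart of the matter is to produce vectors [g 0, g 1, ...] of [Y],
    bounded and disjointly supported with respect to [y], whose images are
    arbitrarily close to vectors [h 0, h 1, ...] of [X] that are bounded away
    from 0 and disjointly supported with respect to [x]. Given such sequences,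
    for all scalars [a n],
    - the upper estimate in [Y] bounds [\sum a n *: g n] from above by the
      [ell q] norm of [a] ([upper_estimate_blocks]);
    - the lower estimate in [X] bounds [\sum a n *: h n] from below by that
      norm ([lower_estimate_blocks]), and so does it for
      [T (\sum a n *: g n) = \sum a n *: T (g n)], as the errors
      [T (g n) - h n] decay fast enough ([lower_estimate_perturb]).
    Since [T] is bounded, [a |-> \sum a n *: g n] embeds [ell q] into [Y], and
    its composition with [T] embeds [ell q] into [X]
    ([contains_ell_of_equivalence]).

    The blocks come from a gliding hump ([almost_preserved_blocks]). It is
    usually run on coordinatewise null sequences, which rests on the continuity
    of the coordinate functionals, a Baire category argument. That is avoided
    here. For finitely many linear forms on [Y], continuous or not, the unit
    ball is precompact modulo the intersection [W] of their kernels, in the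
    sense that for every [e] it has a finite partition such that two points of
    the same cell differ by a vector [e]-close to [W]
    ([ball_precompact_mod_kers]). Indeed the forms may be added one at a time. A
    form that is bounded on the subspace reached so far takes values in a disc,
    which is cut into small pieces; a form that is unbounded on it can be
    corrected to 0 by an arbitrarily small vector. So if [T] were small on the
    bounded part of [W], then the image of the ball would be totally bounded,
    and [T] compact. Hence [W] contains bounded vectors [w] with [T w] bounded
    below ([large_vector_in_finite_codimension]). Take for the forms the
    coordinates of [u] on the indices used by the previous [g n] and the
    coordinates of [T u] on those used by the previous [h n], and truncate the
    expansions of [w] and of [T w]: this gives the next [g n] and [h n], with
    supports that are disjoint from the earlier ones by construction. *)

Set Implicit Arguments.
Unset Strict Implicit.
Unset Printing Implicit Defensive.

Import Order.TTheory GRing.Theory Num.Theory numFieldNormedType.Exports.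

Local Open Scope classical_set_scope.
Local Open Scope ring_scope.

(** * The modulus of scalars *)

Section Modulus.
Context {R : realType} {k : scalar_kind}.
Implicit Types (a b : scalar_field R k).

Lemma modulus_ge0 a : 0 <= modulus a.
Proof.
by case: k a => [a|[a b]] /=; [exact: normr_ge0|exact: sqrtr_ge0].
Qed.

Lemma modulusM a b : modulus (a * b) = modulus a * modulus b.
Proof. by case: k a b => a b /=; [exact: normrM|exact: Normc.normcM]. Qed.

Lemma modulus0 : modulus (0 : scalar_field R k) = 0.
Proof. by case: k => /=; [exact: normr0|exact: Normc.normc0]. Qed.

Lemma modulus1 : modulus (1 : scalar_field R k) = 1.
Proof. by case: k => /=; [exact: normr1|exact: Normc.normc1]. Qed.

Lemma modulusN a : modulus (- a) = modulus a.
Proof. by case: k a => a /=; [exact: normrN|exact: normcN]. Qed.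

Lemma modulusV a : modulus a^-1 = (modulus a)^-1.
Proof. by case: k a => a /=; [exact: normfV|exact: Normc.normcV]. Qed.

End Modulus.

(** A colour names a cell of a partition. Total boundedness is phrased with
    finite colourings throughout: unlike a finite net, a colouring needs no
    choice of centres, and two colourings are refined by pairing them. *)
Lemma real_coloring (R : realType) (M e : R) : 0 < e ->
  exists N (c : R -> 'I_N), forall a b, `|a| <= M -> `|b| <= M ->
    c a = c b -> `|a - b| < e.
Proof.
move=> e0; exists (Num.truncn (2 * M / e)).+1.
exists (fun a => inord (Num.truncn ((a + M) / e))) => a b.
rewrite !ler_norml => /andP[a1 a2] /andP[b1 b2] /(congr1 val) /=.
have le t : - M <= t -> t <= M -> 0 <= (t + M) / e <= 2 * M / e.
  move=> t1 t2; rewrite divr_ge0 ?(ltW e0)//= ?ler_pM2r ?invr_gt0//; lra.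
have /andP[a3 a4] := le a a1 a2; have /andP[b3 b4] := le b b1 b2.
rewrite !inordK ?ltnS ?le_truncn// => h.
have /andP[a5 a6] := truncn_itv a3; have /andP[b5 b6] := truncn_itv b3.
rewrite h in a5 a6; rewrite -natr1 in a6 b6.
have : `|(a + M) / e - (b + M) / e| < 1 by rewrite ltr_norml; lra.
rewrite -mulrBl normrM normfV (gtr0_norm e0) ltr_pdivrMr// mul1r.
by rewrite opprD addrACA subrr addr0.
Qed.

Lemma scalar_coloring (R : realType) (k : scalar_kind) (M e : R) : 0 < e ->
  exists N (c : scalar_field R k -> 'I_N), forall a b,
    modulus a <= M -> modulus b <= M -> c a = c b -> modulus (a - b) < e.
Proof.
case: k => e0 /=; first exact: real_coloring.
have [N [c cP]] := real_coloring M (divr_gt0 e0 (@ltr0n R 2)).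
exists #|{: 'I_N * 'I_N}|.
exists (fun z : R[i] => enum_rank (c (complex.Re z), c (complex.Im z))).
have part (z : R[i]) : `|complex.Re z| <= Normc.normc z /\
    `|complex.Im z| <= Normc.normc z.
  case: z => u v /=; rewrite -!sqrtr_sqr !ler_wsqrtr// ?lerDl ?lerDr ?sqr_ge0//.
move=> a b aM bM /enum_rank_inj[] re im.
have [a1 a2] := part a; have [b1 b2] := part b.
have := cP _ _ (le_trans a1 aM) (le_trans b1 bM) re.
have := cP _ _ (le_trans a2 aM) (le_trans b2 bM) im.
case: a b {re im aM bM a1 a2 b1 b2} => [a1 a2] [b1 b2] /= im re.
set u := a1 - b1 in re *; set v := a2 - b2 in im *.
apply: (@le_lt_trans _ _ (`|u| + `|v|)); last by lra.
rewrite -(ler_sqr (sqrtr_ge0 _)) ?nnegrE ?addr_ge0//.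
rewrite sqr_sqrtr ?addr_ge0 ?sqr_ge0// [leRHS]sqrrD !real_normK ?num_real//.
by rewrite addrAC lerDl mulrn_wge0// mulr_ge0.
Qed.

(** * Quasi-norms *)

Section QuasiNorm.
Context {R : realType} {k : scalar_kind} {V : quasiBanachType R k}.
Implicit Types (u v : V) (s : nat -> V) (a : scalar_field R k).

Lemma qnorm0 : qnorm (0 : V) = 0.
Proof. by rewrite -(scale0r (0 : V)) qnormZ modulus0 mul0r. Qed.

Lemma qnormN v : qnorm (- v) = qnorm v.
Proof. by rewrite -scaleN1r qnormZ modulusN modulus1 mul1r. Qed.

Lemma qnormB v u : qnorm (v - u) = qnorm (u - v).
Proof. by rewrite -qnormN opprB. Qed.

Lemma qcvgP (F : set_system V) (FF : Filter F) v :
  F --> v <-> forall e, 0 < e -> F [set u | qnorm (v - u) < e].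
Proof.
split=> [Fv e e0|Fv A].
  apply: Fv; apply/nbhsP.
  rewrite /nbhs_ /=.
  exists [set uv : V * V | qnorm (uv.1 - uv.2) < e].
    by rewrite /= entourage_qnormE; exists e.
  by move=> u /=; rewrite /xsection /= inE.
move=> /nbhsP[E]; rewrite /= entourage_qnormE => -[e /= e0 eE] EA.
apply: filterS (Fv _ e0) => u /= ue; apply: EA.
by rewrite /xsection /= inE; apply: eE.
Qed.

Definition qlim_to s v :=
  forall e, 0 < e -> exists N, forall n, (N <= n)%N -> qnorm (v - s n) < e.

Lemma qnorm_seq_complete s :
  (forall e, 0 < e -> exists N, forall m n, (N <= m)%N -> (N <= n)%N ->
     qnorm (s m - s n) < e) ->
  exists v, qlim_to s v.
Proof.
move=> sC; have : cauchy (s @ \oo).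
  rewrite /cauchy => E /=; rewrite entourage_qnormE => -[e /= e0 eE].
  have [N NP] := sC e e0.
  exists (s @` [set n | N <= n]%N, s @` [set n | N <= n]%N).
    by split=> /=; exists N => // n /= Nn; exists n.
  by case=> _ _ /= [[m Nm <-] [n Nn <-]]; apply: eE; exact: NP.
move=> /qnorm_complete[v sv]; exists v => e e0.
have /qcvgP/(_ e e0)[N _ NP] := sv.
by exists N => n Nn; exact: NP.
Qed.

End QuasiNorm.

(** A constant at least 1 can be iterated without tracking its sign. *)
Lemma quasi_triangle (R : realType) (k : scalar_kind)
    (V : quasiBanachType R k) : exists2 K : R, 1 <= K &
  forall u v : V, qnorm (u + v) <= K * (qnorm u + qnorm v).
Proof.
have [K KP] := @ler_qnormD R k V; exists (Num.max 1 K) => [|u v].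
  by rewrite le_max lexx.
apply: le_trans (KP _ _) _.
by rewrite ler_wpM2r ?addr_ge0 ?qnorm_ge0// le_max lexx orbT.
Qed.

(** * Expansions with respect to an unconditional basis *)

#[local] Existing Instance totally_filter.

Section Expansions.
Context {R : realType} {k : scalar_kind} {V : quasiBanachType R k}.
Context {I : countType} (x : I -> V).
Implicit Types (f g : V) (a b : I -> scalar_field R k) (A B : {fset I}).

Let psum a A : V := partial_sum (fun i => a i *: x i) A.

Lemma expandsP a f : expands x a f <-> forall e, 0 < e -> exists A,
  forall B, (A `<=` B)%fset -> qnorm (f - psum a B) < e.
Proof.
split=> [/(qcvgP _) af e e0|af].
  by have [A _ AP] := af e e0; exists A => B AB; exact: AP.
apply/(qcvgP _) => e e0; have [A AP] := af e e0.
by exists A => // B /= AB; exact: AP.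
Qed.

Lemma psum_lin c a b A :
  psum (fun i => c * a i + b i) A = c *: psum a A + psum b A.
Proof.
rewrite /psum /partial_sum scaler_sumr -big_split /=.
by apply: eq_bigr => i _; rewrite scalerDl scalerA.
Qed.

Lemma expands_lin c a b f g : expands x a f -> expands x b g ->
  expands x (fun i => c * a i + b i) (c *: f + g).
Proof.
move=> /expandsP af /expandsP bg; apply/expandsP => e e0.
have [K K1 tri] := quasi_triangle V.
have K0 : 0 < K by apply: lt_le_trans K1.
have c0 : 0 < modulus c + 1 by rewrite ltr_wpDl ?modulus_ge0.
have e1 : 0 < e / (2 * K) by rewrite divr_gt0// mulr_gt0.
have [A AP] := af _ (divr_gt0 e1 c0); have [B BP] := bg _ e1.
exists (A `|` B)%fset => C; rewrite fsubUset => /andP[AC BC].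
rewrite psum_lin opprD addrACA -scalerBr.
apply: le_lt_trans (tri _ _) _; rewrite qnormZ.
have := BP _ BC; have := AP _ AC; rewrite ltr_pdivlMr// ltr_pdivlMr ?mulr_gt0//.
move=> fA; rewrite ltr_pdivlMr ?mulr_gt0// => gB.
have : modulus c * qnorm (f - psum a C) <= qnorm (f - psum a C) * (modulus c + 1).
  by rewrite mulrC ler_wpM2l ?qnorm_ge0// lerDl.
move=> h; have := ler_wpM2r (ltW (mulr_gt0 (@ltr0n R 2) K0)) h; lra.
Qed.

(** The net of partial sums is eventually constant. *)
Lemma expands_psum a A :
  expands x (fun i => if i \in A then a i else 0) (psum a A).
Proof.
apply/expandsP => e e0; exists A => B AB.
suff -> : psum (fun i => if i \in A then a i else 0) B = psum a A.
  by rewrite subrr qnorm0.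
have E c C : psum c C = \sum_(i <- C) c i *: x i.
  by rewrite /psum /partial_sum big_seq_fsetE.
rewrite !E -(big_fset_incl _ AB) => [|i iB iA]; last by rewrite (negPf iA) scale0r.
by rewrite !big_seq; apply: eq_bigr => i ->.
Qed.

Definition basis_coord f : I -> scalar_field R k :=
  xget (fun=> 0) [set a | expands x a f].

Hypothesis hx : unconditional_basis x.

Lemma expands_coord (f : V) : expands x (basis_coord f) f.
Proof.
have [a [af _]] := hx f.
by apply: (@xgetPex _ (fun=> 0) [set a | expands x a f]); exists a.
Qed.

Arguments expands_coord : clear implicits.
Arguments expands_psum : clear implicits.
Arguments expands_lin : clear implicits.

Lemma coordE f a : expands x a f -> basis_coord f = a.
Proof.
move=> af; have [b [_ bU]] := hx f.
by rewrite -(bU _ af) -(bU _ (expands_coord f)).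
Qed.

Lemma coord_lin c f g i :
  basis_coord (c *: f + g) i = c * basis_coord f i + basis_coord g i.
Proof.
by have /coordE -> := expands_lin c _ _ _ _ (expands_coord f) (expands_coord g).
Qed.

Lemma bsupportE f : bsupport x f = [set i | basis_coord f i != 0].
Proof.
apply/seteqP; split=> i /= [].
  by move=> a /coordE ->.
by move=> fi; exists (basis_coord f); first exact: expands_coord.
Qed.

Lemma bsupportZ c f : bsupport x (c *: f) `<=` bsupport x f.
Proof.
rewrite !bsupportE => i /=; apply: contraNN => /eqP fi.
have c0 : basis_coord 0 i = 0.
  have := coord_lin (- 1) 0 0 i; rewrite scaler0 addr0 => ->.
  by rewrite mulN1r addNr.
by have := coord_lin c f 0 i; rewrite addr0 fi c0 mulr0 addr0 => ->.
Qed.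

(** Truncating the expansion to a large finite set of indices creates no new
    support. *)
Lemma finite_approximation f e : 0 < e -> exists g,
  [/\ finite_set (bsupport x g), bsupport x g `<=` bsupport x f &
      qnorm (f - g) < e].
Proof.
move=> e0; have /expandsP/(_ e e0)[A AP] := expands_coord f.
exists (psum (basis_coord f) A); split; last exact: AP.
- rewrite bsupportE (coordE (expands_psum _ _)).
  apply: (sub_finite_set (B := [set` A])); last exact: finite_fset.
  by move=> i /=; case: ifP => //; rewrite eqxx.
- rewrite !bsupportE (coordE (expands_psum _ _)) => i /=.
  by case: ifP => //; rewrite eqxx.
Qed.

End Expansions.

(** * Compactness by finite colourings *)

Section Operator.
Context {R : realType} {k : scalar_kind} {Y X : quasiBanachType R k}.

(** The closure of the image is compact because every ultrafilter on it
    converges: of finitely many small sets that cover it, an ultrafilter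
    contains one, so it is Cauchy, and the space is complete. *)
Lemma compact_operatorP (T : Y -> X) :
  (forall e, 0 < e -> exists N (c : Y -> 'I_N), forall u v,
     qnorm u <= 1 -> qnorm v <= 1 -> c u = c v -> qnorm (T u - T v) < e) ->
  compact_operator T.
Proof.
move=> Ttb; rewrite /compact_operator precompactE compact_ultra => F FU FT.
have [K K1 tri] := quasi_triangle X.
have K0 : 0 < K by apply: lt_le_trans K1.
have FC : cauchy F.
  move=> E /=; rewrite entourage_qnormE => -[e /= e0 eE].
  (* Two uses of the quasi-triangle inequality cost at most [3 * K ^+ 2 * d]. *)
  pose d := e / (4 * K ^+ 2).
  have d0 : 0 < d by rewrite divr_gt0// mulr_gt0// exprn_gt0.
  have [N [c cP]] := Ttb d d0.
  (* The balls around points of the image absorb the passage to the closure. *)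
  pose cell (i : 'I_N) : set X := [set w | exists u,
    [/\ qnorm u <= 1, c u = i & qnorm (w - T u) < d]].
  have : exists i, F (cell i).
    apply: contrapT => /forallNP Fn.
    have Fn' : F [set w | forall i, (~` cell i) w].
      apply: filter_forall => i.
      by have [/Fn|] := in_ultra_setVsetC (cell i) FU.
    suff : F ([set w | forall i, (~` cell i) w] `&`
              closure (T @` [set v | qnorm v <= 1])).
      move=> /filter_ex[w [/= wn wT]].
      have wd : nbhs w [set w' | qnorm (w - w') < d].
        apply/nbhsP; exists [set uv : X * X | qnorm (uv.1 - uv.2) < d].
          by rewrite entourage_qnormE; exists d.
        by move=> u /=; rewrite /xsection /= inE.
      have [_ [[u u1 <-] /= ud]] := wT _ wd.
      by apply: (wn (c u)); exists u.
    exact: filterI.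
  move=> [i Fi]; exists (cell i, cell i) => //=.
  move=> [w w'] /= [[u [u1 ui ud]] [u' [u1' ui' ud']]]; apply: eE => /=.
  have := cP u u' u1 u1' (etrans ui (esym ui')) => uu.
  rewrite (_ : w - w' = (w - T u) + ((T u - T u') + (T u' - w')));
    last by rewrite !subrKA.
  apply: le_lt_trans (tri _ _) _.
  have := tri (T u - T u') (T u' - w'); rewrite (qnormB _ w') => h.
  have : K * (qnorm (w - T u) + qnorm (T u - T u' + (T u' - w'))) <
         K * (d + K * (d + d)).
    rewrite ltr_pM2l// ltrD//; apply: le_lt_trans h _.
    by rewrite ltr_pM2l// ltrD.
  move=> /lt_le_trans; apply.
  apply: (@le_trans _ _ (K * (K * d + K * (d + d)))).
    by rewrite ler_wpM2l ?(ltW K0)// lerD2r ler_peMl// ltW.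
  have -> : K * (K * d + K * (d + d)) = 3 / 4 * e.
    by rewrite /d; field; rewrite gt_eqF.
  lra.
have [w Fw] := qnorm_complete F _ FC.
exists w; split=> //; apply: closed_closure => B Bw.
exact: filter_ex (filterI FT (Fw _ Bw)).
Qed.

End Operator.

(** * The unit ball modulo finitely many linear forms *)

Section FiniteCodimension.
Context {R : realType} {k : scalar_kind} {V : quasiBanachType R k}.
Implicit Types (W : set V) (phi : V -> scalar_field R k).

Definition linear_subspace W := W 0 /\ forall c u v, W u -> W v -> W (c *: u + v).

Definition linear_form phi :=
  forall c u v, phi (c *: u + v) = c * phi u + phi v.

(** Precompactness of the image of the unit ball in the quotient by [W]. *)
Definition ball_precompact_mod W := forall e, 0 < e ->
  exists N (c : V -> 'I_N), forall u v,
    qnorm u <= 1 -> qnorm v <= 1 -> c u = c v ->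
    exists2 w, W w & qnorm (u - v - w) < e.

Lemma subspaceZ W c u : linear_subspace W -> W u -> W (c *: u).
Proof. by move=> [W0 WD] Wu; rewrite -[_ *: _]addr0; exact: WD. Qed.

Lemma subspaceB W u v : linear_subspace W -> W u -> W v -> W (u - v).
Proof. by move=> [W0 WD] Wu Wv; rewrite addrC -scaleN1r; exact: WD. Qed.

Lemma linear_form0 phi : linear_form phi -> phi 0 = 0.
Proof.
move=> phiD; have := phiD (- 1) 0 0.
by rewrite scaler0 addr0 mulN1r addNr.
Qed.

Lemma linear_formZ phi c u : linear_form phi -> phi (c *: u) = c * phi u.
Proof. by move=> h; have := h c u 0; rewrite !addr0 (linear_form0 h) addr0. Qed.

Lemma linear_formB phi u v : linear_form phi -> phi (u - v) = phi u - phi v.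
Proof. by move=> h; rewrite addrC -scaleN1r h mulN1r addrC. Qed.

(** An unbounded form takes any prescribed value at arbitrarily small vectors of
    [W], so a vector of [W] becomes a vector of the kernel after an arbitrarily
    small change, and the partition for [W] serves for the kernel. *)
Lemma ball_precompact_mod_ker_unbounded W phi :
  linear_subspace W -> linear_form phi ->
  (forall M, exists2 w, W w & M * qnorm w < modulus (phi w)) ->
  ball_precompact_mod W ->
  ball_precompact_mod (W `&` [set u | phi u = 0]).
Proof.
move=> sW phiD unbd tbW e e0.
have [K K1 tri] := quasi_triangle V.
have K0 : 0 < K by apply: lt_le_trans K1.
have d0 : 0 < e / (2 * K) by rewrite divr_gt0// mulr_gt0.
have [N [c cP]] := tbW _ d0; exists N, c => u v u1 v1 cuv.
have [w Ww wd] := cP u v u1 v1 cuv.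
pose a := modulus (phi w).
have a0 : 0 < a + 1 by rewrite ltr_wpDl ?modulus_ge0.
(* At this slope, the multiple of [t] with the same image under [phi] as [w]
   is smaller than [e / (2 * K)]; adding 1 keeps the slope positive. *)
have [t Wt] := unbd ((a + 1) / (e / (2 * K))).
have M0 := divr_gt0 a0 d0.
move=> tM.
have t0 : 0 < modulus (phi t).
  by apply: le_lt_trans tM; rewrite mulr_ge0 ?qnorm_ge0 ?ltW.
have pt0 : phi t != 0.
  by apply/eqP => pt; rewrite pt modulus0 ltxx in t0.
exists (w - (phi w / phi t) *: t).
  split; first by apply: subspaceB => //; exact: subspaceZ.
  by rewrite /= linear_formB// linear_formZ// divfK// subrr.
rewrite opprB addrA addrAC.
apply: le_lt_trans (tri _ _) _.
have zd : qnorm ((phi w / phi t) *: t) < e / (2 * K).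
  rewrite qnormZ modulusM modulusV -/a mulrAC ltr_pdivrMr//.
  move: tM; rewrite mulrAC ltr_pdivrMr// mulrC [X in _ < X]mulrC => tM.
  apply: le_lt_trans tM.
  by rewrite [leRHS]mulrC ler_wpM2r ?qnorm_ge0// lerDl.
have : K * (qnorm (u - v - w) + qnorm ((phi w / phi t) *: t)) <
    K * (e / (2 * K) + e / (2 * K)) by rewrite ltr_pM2l// ltrD.
by congr (_ < _); field; rewrite gt_eqF.
Qed.

(** Refine the partition for [W] as follows: the displacement of [u] from a
    fixed representative of its cell is close to some [p u] in [W], and the values
    [phi (p u)] stay in a disc, which is cut into small pieces. For [u] and [v]
    in the same refined cell, [p u - p v] is in [W], is close to [u - v], and
    nearly annihilates [phi]; a small multiple of a fixed vector then moves it
    into the kernel. *)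
Lemma ball_precompact_mod_ker_bounded W phi M :
  linear_subspace W -> linear_form phi ->
  (forall w, W w -> modulus (phi w) <= M * qnorm w) ->
  ball_precompact_mod W ->
  ball_precompact_mod (W `&` [set u | phi u = 0]).
Proof.
move=> sW phiD phiM tbW e e0.
(* The fixed vector is [w1]; there is none only if [phi] vanishes on [W]. *)
have [[w1 [Ww1 pw1]]|/forallNP triv] :=
    pselect (exists w, W w /\ phi w = 1); last first.
  have ker w : W w -> phi w = 0.
    move=> Ww; apply: contrapT => /eqP pw; apply: (triv ((phi w)^-1 *: w)).
    by split; [exact: subspaceZ|rewrite linear_formZ// mulVf].
  have [N [c cP]] := tbW _ e0; exists N, c => u v u1 v1 cuv.
  by have [w Ww wd] := cP u v u1 v1 cuv; exists w => //; split=> //; exact: ker.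
have [K K1 tri] := quasi_triangle V.
have K0 : 0 < K by apply: lt_le_trans K1.
pose d := Num.min 1 (e / (4 * K ^+ 2)).
have d0 : 0 < d by rewrite lt_min ltr01 divr_gt0// mulr_gt0// exprn_gt0.
have d1 : d <= 1 by rewrite ge_min lexx.
have dK : d * (4 * K ^+ 2) <= e.
  by rewrite -ler_pdivlMr ?mulr_gt0 ?exprn_gt0// ge_min lexx orbT.
have [N [c cP]] := tbW _ d0.
pose r i := xget 0 [set u | qnorm u <= 1 /\ c u = i].
have rP u : qnorm u <= 1 -> qnorm (r (c u)) <= 1 /\ c (r (c u)) = c u.
  by move=> u1; apply: (@xgetPex _ 0 [set v | qnorm v <= 1 /\ c v = c u]); exists u.
pose p u := xget 0 [set w | W w /\ qnorm (u - r (c u) - w) < d].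
have pP u : qnorm u <= 1 -> W (p u) /\ qnorm (u - r (c u) - p u) < d.
  move=> u1; apply: (@xgetPex _ 0 [set w | W w /\ qnorm (u - r (c u) - w) < d]).
  have [r1 cr] := rP u u1.
  by have [w Ww wd] := cP u _ u1 r1 (esym cr); exists w.
have pK u : qnorm u <= 1 -> qnorm (p u) <= K * (d + K * (1 + 1)).
  move=> u1; have [_ ud] := pP u u1; have [r1 _] := rP u u1.
  rewrite -qnormN (_ : - p u = (u - r (c u) - p u) + (r (c u) - u)); last first.
    by rewrite addrAC subrKA subrr sub0r.
  apply: le_trans (tri _ _) _; rewrite ler_pM2l// lerD ?(ltW ud)//.
  by apply: le_trans (tri _ _) _; rewrite ler_pM2l// lerD// qnormN.
pose h := e / (2 * K * (qnorm w1 + 1)).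
have w10 : 0 < qnorm w1 + 1 by rewrite ltr_wpDl ?qnorm_ge0.
have h0 : 0 < h by rewrite divr_gt0// mulr_gt0// mulr_gt0.
have [N' [c' c'P]] := scalar_coloring k (`|M| * (K * (d + K * (1 + 1)))) h0.
exists #|{: 'I_N * 'I_N'}|.
exists (fun u => enum_rank (c u, c' (phi (p u)))).
move=> u v u1 v1 /enum_rank_inj[] cuv cuv'.
have [Wu ud] := pP u u1; have [Wv vd] := pP v v1.
have bd z : qnorm z <= 1 -> modulus (phi (p z)) <= `|M| * (K * (d + K * (1 + 1))).
  move=> z1; apply: le_trans (phiM _ (pP z z1).1) _.
  apply: (@le_trans _ _ (`|M| * qnorm (p z))).
    by rewrite ler_wpM2r ?qnorm_ge0// ler_norm.
  by rewrite ler_wpM2l// pK.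
have := c'P _ _ (bd u u1) (bd v v1) cuv'; rewrite -linear_formB//.
set D := p u - p v => Dh.
have WD : W D by exact: subspaceB.
exists (D - phi D *: w1).
  split; first by apply: subspaceB => //; exact: subspaceZ.
  by rewrite /= linear_formB// linear_formZ// pw1 mulr1 subrr.
rewrite (_ : u - v - (D - phi D *: w1) =
  ((u - r (c u) - p u) - (v - r (c v) - p v)) + phi D *: w1); last first.
  rewrite -cuv opprD opprK addrA; congr (_ + _).
  rewrite [in RHS]opprD [RHS]addrACA -[X in _ = _ + X]opprD; congr (_ + _).
  by rewrite opprD addrACA subrr addr0.
apply: le_lt_trans (tri _ _) _; rewrite qnormZ.
have h1 : qnorm (u - r (c u) - p u - (v - r (c v) - p v)) < K * (d + d).
  by apply: le_lt_trans (tri _ _) _; rewrite ltr_pM2l// qnormN ltrD.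
have h2 : modulus (phi D) * qnorm w1 <= h * (qnorm w1 + 1).
  by rewrite ler_pM ?modulus_ge0 ?qnorm_ge0 ?(ltW Dh)// lerDl.
have : K * (qnorm (u - r (c u) - p u - (v - r (c v) - p v)) +
    modulus (phi D) * qnorm w1) < K * (K * (d + d) + h * (qnorm w1 + 1)).
  by rewrite ltr_pM2l// ltr_leD.
move=> /lt_le_trans; apply.
have -> : h * (qnorm w1 + 1) = e / (2 * K).
  by rewrite /h; field; rewrite !gt_eqF.
have -> : K * (K * (d + d) + e / (2 * K)) = d * (4 * K ^+ 2) / 2 + e / 2.
  by field; rewrite gt_eqF.
lra.
Qed.

Lemma ball_precompact_mod_ker W phi :
  linear_subspace W -> linear_form phi -> ball_precompact_mod W ->
  ball_precompact_mod (W `&` [set u | phi u = 0]).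
Proof.
move=> sW phiD.
have [[M phiM]|/forallNP unbd] := pselect (exists M, forall w, W w ->
    modulus (phi w) <= M * qnorm w).
  exact: ball_precompact_mod_ker_bounded phiM.
apply: ball_precompact_mod_ker_unbounded => // M.
have /existsNP[w /not_implyP[Ww /negP]] := unbd M.
by rewrite -ltNge; exists w.
Qed.

Lemma ball_precompact_mod_kers (J : choiceType)
    (phi : J -> V -> scalar_field R k) (A : set J) :
  finite_set A -> (forall j, linear_form (phi j)) ->
  ball_precompact_mod [set u | forall j, A j -> phi j u = 0].
Proof.
move=> /finite_seqP[s ->] phiD; elim: s => [|j s ih].
  move=> e e0; exists 1, (fun=> ord0) => u v _ _ _.
  by exists (u - v) => //; rewrite subrr qnorm0.
rewrite (_ : [set u | _] = [set u | forall j, [set` s] j -> phi j u = 0] `&`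
    [set u | phi j u = 0]).
  apply: ball_precompact_mod_ker => //.
  split=> [i _|c u v u0 v0 i si]; first exact: linear_form0.
  by rewrite phiD u0// v0// mulr0 addr0.
apply/seteqP; split=> u /= => [h|[h1 h2] i].
  by split=> [i si|]; apply: h; rewrite inE ?eqxx ?si ?orbT.
by rewrite inE => /orP[/eqP->//|]; exact: h1.
Qed.

End FiniteCodimension.

(** * Blocks almost preserved by a non-compact operator *)

Lemma bounded_operator_gt0 (R : realType) (k : scalar_kind)
    (Y X : quasiBanachType R k) (T : Y -> X) : bounded_operator T ->
  exists2 C : R, 0 < C & forall v, qnorm (T v) <= C * qnorm v.
Proof.
move=> [C CP]; exists (`|C| + 1) => [|v]; first by rewrite ltr_wpDl.
apply: le_trans (CP v) _; rewrite ler_wpM2r ?qnorm_ge0//.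
by rewrite (le_trans (ler_norm _))// lerDl.
Qed.

(** Two points of the unit ball in the same cell modulo [W] differ by a vector
    of [W] of size at most [K] up to a small error. If [T] were small on all such
    vectors, the cells would make the image of the ball totally bounded. The
    constants come out independent of [W]. *)
Lemma large_vector_in_finite_codimension (R : realType) (k : scalar_kind)
    (Y X : quasiBanachType R k) (T : {linear Y -> X}) :
  bounded_operator T -> ~ compact_operator T ->
  exists K d : R, 0 < d /\ forall W : set Y, ball_precompact_mod W ->
    exists w, [/\ W w, qnorm w <= K & d <= qnorm (T w)].
Proof.
move=> /bounded_operator_gt0[C C0 TC] Tnc.
have [KX KX1 triX] := quasi_triangle X.
have [KY KY1 triY] := quasi_triangle Y.
have KX0 : 0 < KX by apply: lt_le_trans KX1.
have KY0 : 0 < KY by apply: lt_le_trans KY1.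
apply: contrapT => no; apply: Tnc; apply: compact_operatorP => e e0.
pose b := e / (2 * KX).
have b0 : 0 < b by rewrite divr_gt0// mulr_gt0.
apply: contrapT => ntb; apply: no; exists (KY * (1 + KY * (1 + 1))), b.
split=> // W tbW; apply: contrapT => noW; apply: ntb.
pose d := Num.min 1 (b / C).
have d0 : 0 < d by rewrite lt_min ltr01 divr_gt0.
have [N [c cP]] := tbW d d0; exists N, c => u v u1 v1 cuv.
have [w Ww wd] := cP u v u1 v1 cuv.
have wK : qnorm w <= KY * (1 + KY * (1 + 1)).
  rewrite -qnormN (_ : - w = (u - v - w) + (v - u)); last first.
    by rewrite addrAC subrKA subrr sub0r.
  apply: le_trans (triY _ _) _; rewrite ler_pM2l// lerD//.
    by apply: le_trans (ltW wd) _; rewrite ge_min lexx.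
  by apply: le_trans (triY _ _) _; rewrite ler_pM2l// lerD// qnormN.
have Twb : qnorm (T w) < b.
  by rewrite ltNge; apply/negP => bT; apply: noW; exists w.
have -> : T u - T v = T (u - v - w) + T w by rewrite -linearD subrK linearB.
apply: le_lt_trans (triX _ _) _.
have : qnorm (T (u - v - w)) < b.
  apply: le_lt_trans (TC _) _; rewrite mulrC -ltr_pdivlMr//.
  by apply: lt_le_trans wd _; rewrite ge_min lexx orbT.
move=> Tub; have : KX * (qnorm (T (u - v - w)) + qnorm (T w)) < KX * (b + b).
  by rewrite ltr_pM2l// ltrD.
suff <- : KX * (b + b) = e by [].
by rewrite /b; field; rewrite gt_eqF.
Qed.

(** The gliding hump. A vector [w] of the previous lemma is taken in the common
    kernel of the coordinates in [F] and of the coordinates in [G] composed with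
    [T]; truncating [w] and [T w] keeps their supports off [F] and [G]. *)
Lemma almost_preserved_blocks (R : realType) (k : scalar_kind)
    (Y X : quasiBanachType R k) (T : {linear Y -> X}) (I J : countType)
    (x : I -> X) (y : J -> Y) :
  unconditional_basis x -> unconditional_basis y ->
  bounded_operator T -> ~ compact_operator T ->
  exists K d : R, [/\ 0 < K, 0 < d &
    forall (F : set J) (G : set I) (e : R),
      finite_set F -> finite_set G -> 0 < e -> exists g h,
    [/\ finite_set (bsupport y g), bsupport y g `&` F = set0, qnorm g <= K &
     [/\ finite_set (bsupport x h), bsupport x h `&` G = set0,
         d <= qnorm h & qnorm (T g - h) < e]]].
Proof.
move=> hx hy hT Tnc.
have [K [d [d0 Kd]]] := large_vector_in_finite_codimension hT Tnc.
have [C C0 TC] := bounded_operator_gt0 hT.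
have [KX KX1 triX] := quasi_triangle X.
have [KY KY1 triY] := quasi_triangle Y.
have KX0 : 0 < KX by apply: lt_le_trans KX1.
have KY0 : 0 < KY by apply: lt_le_trans KY1.
exists (KY * (`|K| + 1)), (d / (2 * KX)); split.
- by rewrite mulr_gt0// ltr_wpDl.
- by rewrite divr_gt0// mulr_gt0.
move=> F G e finF finG e0.
(* A single family of forms, indexed by both kinds of coordinates. *)
pose phi (s : J + I) : Y -> scalar_field R k :=
  match s with
  | inl j => fun u => basis_coord y u j
  | inr i => fun u => basis_coord x (T u) i
  end.
have phiD s : linear_form (phi s).
  by case: s => [j|i] c u v /=; rewrite ?linearP coord_lin.
pose A : set (J + I) := [set s | match s with inl j => F j | inr i => G i end].
have finA : finite_set A.
  apply: (@sub_finite_set _ _ ((inl @` F) `|` (inr @` G))).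
    by case=> [j Fj|i Gi]; [left; exists j|right; exists i].
  by rewrite finite_setU; split; exact: finite_image.
have [w [Aw wK dw]] := Kd _ (ball_precompact_mod_kers finA phiD).
pose b := Num.min (Num.min 1 (d / (2 * KX))) (e / (KX * (C + 1))).
have C1 : 0 < C + 1 by rewrite ltr_wpDl ?ltW.
have b0 : 0 < b by rewrite !lt_min ltr01 !divr_gt0// mulr_gt0.
have [g [fing gw wg]] := finite_approximation hy w b0.
have [h [finh hw wh]] := finite_approximation hx (T w) b0.
exists g, h; split=> //.
- apply/seteqP; split=> // j [/gw + Fj]; rewrite bsupportE//= => /eqP; apply.
  exact: (Aw (inl j)).
- rewrite (_ : g = w + (g - w)); last by rewrite addrC subrK.
  apply: le_trans (triY _ _) _; rewrite ler_pM2l// lerD//.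
    by rewrite (le_trans wK)// ler_norm.
  by rewrite qnormB (le_trans (ltW wg))// /b !ge_min lexx.
split=> //.
- apply/seteqP; split=> // i [/hw + Gi]; rewrite bsupportE//= => /eqP; apply.
  exact: (Aw (inr i)).
- have := triX (T w - h) h; rewrite subrK => /(le_trans dw).
  have bd : b <= d / (2 * KX) by rewrite /b !ge_min lexx orbT.
  rewrite mulrC -ler_pdivrMr// => dh.
  have -> : d / (2 * KX) = d / KX - d / (2 * KX) by field; rewrite gt_eqF.
  lra.
- rewrite (_ : T g - h = (T w - h) - T (w - g)); last first.
    by rewrite linearB opprB [RHS]addrC subrKA.
  apply: le_lt_trans (triX _ _) _; rewrite qnormN.
  have Twg : qnorm (T (w - g)) <= C * b.
    by apply: le_trans (TC _) _; rewrite ler_pM2l// ltW.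
  have : KX * (qnorm (T w - h) + qnorm (T (w - g))) < KX * (b + C * b).
    by rewrite ltr_pM2l// ltr_leD.
  move=> /lt_le_trans; apply.
  have : b <= e / (KX * (C + 1)) by rewrite /b !ge_min lexx orbT.
  rewrite ler_pdivlMr ?mulr_gt0//; apply: le_trans.
  by rewrite le_eqVlt; apply/orP; left; apply/eqP; ring.
Qed.

(** * Finite and infinite [ell q] norms *)

Section EllSums.
Context {R : realType} (q : \bar R).
Hypothesis q0 : (0 < q)%E.

Lemma ler_lsum n (t u : 'I_n -> R) :
  (forall j, 0 <= t j <= u j) -> lsum q t <= lsum q u.
Proof.
case: q q0 => [r| |]//; rewrite ?lte_fin => r0 tu /=.
  have r1 : 0 <= r^-1 by rewrite invr_ge0 ltW.
  have s0 (v : 'I_n -> R) : 0 <= \sum_(j < n) v j `^ r.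
    by apply: sumr_ge0 => j _; exact: powR_ge0.
  apply: ge0_ler_powR; rewrite ?nnegrE//; apply: ler_sum => j _.
  have /andP[t0 tju] := tu j.
  by apply: ge0_ler_powR; rewrite ?nnegrE ?(ltW r0)// (le_trans t0).
by apply: le_bigmax2 => j _; have /andP[] := tu j.
Qed.

Lemma lsumZ n (c : R) (t : 'I_n -> R) : 0 <= c -> (forall j, 0 <= t j) ->
  lsum q (fun j => c * t j) = c * lsum q t.
Proof.
case: q q0 => [r| |]//; rewrite ?lte_fin => r0 c0 t0 /=.
  under eq_bigr do rewrite powRM//.
  rewrite -mulr_sumr powRM ?powR_ge0//; last first.
    by apply: sumr_ge0 => j _; exact: powR_ge0.
  by rewrite -powRrM mulfV ?gt_eqF// powRr1.
have E : forall s : seq 'I_n, \big[Num.max/0]_(j <- s) (c * t j) =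
    c * \big[Num.max/0]_(j <- s) t j.
  elim=> [|j s ih]; first by rewrite !big_nil mulr0.
  by rewrite !big_cons ih maxr_pMr.
exact: E.
Qed.

Lemma lsum_ge0 n (t : 'I_n -> R) : 0 <= lsum q t.
Proof.
case: q q0 => [r| |]// r0 /=; first exact: powR_ge0.
exact: bigmax_ge_id.
Qed.

Lemma lsum_ge n (t : 'I_n -> R) j : (forall i, 0 <= t i) -> t j <= lsum q t.
Proof.
case: q q0 => [r| |]//; rewrite ?lte_fin => r0 t0 /=.
  rewrite -[leLHS](powRr1 (t0 j)) -(@mulfV _ r) ?gt_eqF// powRrM.
  have s0 i : 0 <= t i `^ r by exact: powR_ge0.
  apply: ge0_ler_powR; rewrite ?nnegrE ?invr_ge0 ?(ltW r0) ?sumr_ge0//.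
  by rewrite (bigD1 j)//= lerDl sumr_ge0.
exact: le_bigmax.
Qed.

Lemma lsum_widen m n (t : nat -> R) : (forall i, 0 <= t i) -> (m <= n)%N ->
  lsum q (fun j : 'I_m => t j) <= lsum q (fun j : 'I_n => t j).
Proof.
move=> t0 mn; case: q q0 => [r| |]//; rewrite ?lte_fin => r0 /=.
  have s0 i : 0 <= t i `^ r by exact: powR_ge0.
  apply: ge0_ler_powR; rewrite ?nnegrE ?invr_ge0 ?(ltW r0) ?sumr_ge0//.
  rewrite -!(big_mkord xpredT (fun j => t j `^ r)).
  by rewrite (big_cat_nat (leq0n _) mn)//= lerDl sumr_ge0.
apply: bigmax_le => [|i _]; first exact: bigmax_ge_id.
exact: (le_bigmax _ (fun j : 'I_n => t j) (widen_ord mn i)).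
Qed.

End EllSums.

Section Ell.
Context {R : realType} {k : scalar_kind}.
Implicit Types (a : nat -> scalar_field R k) (r : R).

Let psum a r n := \sum_(j < n) modulus (a j) `^ r.

(** The extended series defining the norm is replaced by a real supremum, which
    is all that is used of it below. *)
Lemma ell_fin_sup a r : ell r%:E a ->
  exists L : R, [/\ ell_norm r%:E a = L `^ r^-1, 0 <= L,
    forall n, psum a r n <= L &
    forall B, (forall n, psum a r n <= B) -> L <= B].
Proof.
move=> /= fin; set S := (\sum_(0 <= n <oo) _)%E in fin.
have t0 n : (0 <= (modulus (a n) `^ r)%:E)%E by rewrite lee_fin powR_ge0.
have S0 : (0 <= S)%E by apply: nneseries_ge0 => n _ _.
have SE : S \is a fin_num by rewrite ge0_fin_numE.
have pE n : (psum a r n)%:E = (\sum_(0 <= j < n) (modulus (a j) `^ r)%:E)%E.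
  by rewrite big_mkord sumEFin.
exists (fine S); split=> //.
- exact: fine_ge0.
- move=> n; rewrite -lee_fin fineK// pE.
  exact: (@nneseries_lim_ge _ _ xpredT).
- move=> B pB; rewrite -lee_fin fineK//; apply: lime_le.
    by apply: is_cvg_nneseries => n _ _.
  by near=> n; rewrite -pE lee_fin.
Unshelve. all: by end_near. Qed.

Lemma ell_oo_bounded a : ell +oo a ->
  has_sup (range (fun n => modulus (a n))).
Proof.
move=> /= a0; split; first by exists (modulus (a 0%N)), 0%N.
have /cvgrPdist_lt/(_ 1 ltr01)[N _ NP] := a0.
exists (1 + \sum_(j < N) modulus (a j)) => _ [n _ <-].
have [nN|Nn] := ltnP n N.
  rewrite (bigD1 (Ordinal nN))//= addrCA lerDl addr_ge0// sumr_ge0// => i _.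
  exact: modulus_ge0.
have := NP n Nn; rewrite /= sub0r normrN ger0_norm ?modulus_ge0// => /ltW h.
by rewrite (le_trans h)// lerDl sumr_ge0// => i _; exact: modulus_ge0.
Qed.

Variable q : \bar R.
Hypothesis q0 : (0 < q)%E.

Lemma lsum_le_ell_norm a n : ell q a ->
  lsum q (fun j : 'I_n => modulus (a j)) <= ell_norm q a.
Proof.
case: q q0 => [r| |]//; rewrite ?lte_fin => r0 ea.
  have [L [-> L0 aL _]] := ell_fin_sup ea.
  rewrite /lsum; apply: ge0_ler_powR; rewrite ?nnegrE ?invr_ge0 ?(ltW r0)//.
    by rewrite sumr_ge0// => j _; exact: powR_ge0.
  exact: aL.
have [h1 h2] := ell_oo_bounded ea.
have ub i : modulus (a i) <= ell_norm +oo a by apply: ub_le_sup => //; exists i.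
by apply: bigmax_le => [|i _] //; rewrite (le_trans _ (ub 0%N))// modulus_ge0.
Qed.

Lemma ell_norm_le a B : ell q a ->
  (forall n, lsum q (fun j : 'I_n => modulus (a j)) <= B) ->
  ell_norm q a <= B.
Proof.
case: q q0 => [r| |]//; rewrite ?lte_fin => r0 ea aB.
  have [L [-> L0 _ aL]] := ell_fin_sup ea.
  have B0 : 0 <= B by rewrite (le_trans _ (aB 0%N))// powR_ge0.
  rewrite -[leRHS](powRr1 B0) -(@mulfV _ r) ?gt_eqF// powRrM.
  apply: ge0_ler_powR; rewrite ?nnegrE ?invr_ge0 ?(ltW r0) ?powR_ge0//.
  apply: aL => n; have := aB n; rewrite /lsum.
  have s0 : 0 <= psum a r n by rewrite sumr_ge0// => j _; exact: powR_ge0.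
  move=> h'; rewrite -[leLHS](powRr1 s0) -(@mulVf _ r) ?gt_eqF// powRrM.
  by apply: ge0_ler_powR; rewrite ?nnegrE ?(ltW r0) ?powR_ge0.
rewrite /ell_norm; apply: ge_sup; first by exists (modulus (a 0%N)), 0%N.
move=> _ [n _ <-]; apply: le_trans (aB n.+1).
exact: (le_bigmax _ (fun j : 'I_n.+1 => modulus (a j)) ord_max).
Qed.

(** For [q = +oo] this is what distinguishes [c_0] from [ell_oo]. *)
Lemma ell_tail a e : ell q a -> 0 < e -> exists N, forall m n, (N <= m)%N ->
  lsum q (fun j : 'I_n => if (m <= j)%N then modulus (a j) else 0) < e.
Proof.
case: q q0 => [r| |]//; rewrite ?lte_fin => r0 ea e0.
  have [L [_ L0 La aL]] := ell_fin_sup ea.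
  have er0 : 0 < e `^ r by exact: powR_gt0.
  have [N LN] : exists N, L - e `^ r < psum a r N.
    apply: contrapT => /forallNP no.
    have : L <= L - e `^ r by apply: aL => n; rewrite leNgt; apply/negP; exact: no.
    by lra.
  exists N => m n Nm; rewrite /lsum.
  set s := \sum_(j < n) _.
  have s0 : 0 <= s by rewrite sumr_ge0// => j _; exact: powR_ge0.
  rewrite -[ltRHS](powRr1 (ltW e0)) -(@mulfV _ r) ?gt_eqF// powRrM.
  apply: gt0_ltr_powR; rewrite ?invr_gt0 ?nnegrE ?(ltW er0)//.
  have -> : s = psum a r n - psum a r (minn m n).
    rewrite /s; elim: n {s s0} => [|n ih].
      by rewrite /psum minn0 !big_ord0 subrr.
    rewrite big_ord_recr /= ih; have [mn|nm] := leqP m n.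
      by rewrite (minn_idPl (leqW mn)) /psum big_ord_recr /= addrAC.
    by rewrite (minn_idPr nm) !subrr powR0 ?gt_eqF// addr0.
  have mono i j : (i <= j)%N -> psum a r i <= psum a r j.
    move=> ij; rewrite /psum -!(big_mkord xpredT (fun j => modulus (a j) `^ r)).
    rewrite (big_cat_nat (leq0n _) ij)//= lerDl sumr_ge0// => l _.
    exact: powR_ge0.
  have [mn|nm] := leqP m n; last by rewrite subrr.
  by have := mono _ _ Nm; have := La n; lra.
have /cvgrPdist_lt/(_ e e0)[N _ NP] := ea.
exists N => m n Nm; apply: bigmax_lt => // i _; case: ifP => // mi.
by have := NP i (leq_trans Nm mi); rewrite /= sub0r normrN ger0_norm ?modulus_ge0.
Qed.

End Ell.

(** * Embeddings of [ell q] *)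

Section Limits.
Context {R : realType} {k : scalar_kind} {V : quasiBanachType R k}.
Implicit Types (s t : nat -> V) (u v : V).

Lemma qlim_lin s t u v c : qlim_to s u -> qlim_to t v ->
  qlim_to (fun n => c *: s n + t n) (c *: u + v).
Proof.
move=> su tv e e0; have [K K1 tri] := quasi_triangle V.
have K0 : 0 < K by apply: lt_le_trans K1.
have c0 : 0 < modulus c + 1 by rewrite ltr_wpDl ?modulus_ge0.
have d0 : 0 < e / (2 * K) by rewrite divr_gt0// mulr_gt0.
have [N NP] := su _ (divr_gt0 d0 c0); have [M MP] := tv _ d0.
exists (maxn N M) => n; rewrite geq_max => /andP[Nn Mn].
rewrite opprD addrACA -scalerBr.
apply: le_lt_trans (tri _ _) _; rewrite qnormZ.
have h1 : modulus c * qnorm (u - s n) <= e / (2 * K).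
  have := NP n Nn; rewrite ltr_pdivlMr// => /ltW; apply: le_trans.
  by rewrite mulrC ler_wpM2l ?qnorm_ge0// lerDl.
have : K * (modulus c * qnorm (u - s n) + qnorm (v - t n)) <
    K * (e / (2 * K) + e / (2 * K)) by rewrite ltr_pM2l// ler_ltD// MP.
suff -> : K * (e / (2 * K) + e / (2 * K)) = e by [].
by field; rewrite gt_eqF.
Qed.

Lemma qlim_unique s u v : qlim_to s u -> qlim_to s v -> u = v.
Proof.
move=> su sv; apply: subr0_eq; apply: qnorm_eq0; apply/eqP.
rewrite eq_le qnorm_ge0 andbT.
apply/ler_addgt0Pl => e e0; rewrite addr0.
have uv := qlim_lin (- 1) sv su.
have [N /(_ N (leqnn N))] := uv e e0.
by rewrite !scaleN1r addNr subr0 addrC => /ltW.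
Qed.

End Limits.

Section EllEmbedding.
Context {R : realType} {k : scalar_kind} {Y X : quasiBanachType R k}.
Variables (T : {linear Y -> X}) (q : \bar R) (g : nat -> Y).
Hypotheses (q0 : (0 < q)%E) (hT : bounded_operator T).
Implicit Types (a b : nat -> scalar_field R k).

Let psum a n := \sum_(j < n) a j *: g j.
Let lsum_ a n := lsum q (fun j : 'I_n => modulus (a j)).

Variables (C c : R).
Hypotheses (C0 : 0 < C) (c0 : 0 < c).
Hypothesis upper : forall a n, qnorm (psum a n) <= C * lsum_ a n.
Hypothesis lower : forall a n, c * lsum_ a n <= qnorm (T (psum a n)).

(* On [ell q] the sums converge and the default value is not used. *)
Let S a : Y := xget 0 [set v | qlim_to (psum a) v].

Lemma ell_sumP a : ell q a -> qlim_to (psum a) (S a).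
Proof.
move=> ea; suff [v sv] : exists v, qlim_to (psum a) v.
  by apply: (@xgetPex _ 0 [set v | qlim_to (psum a) v]); exists v.
apply: qnorm_seq_complete => e e0.
have [N NP] := ell_tail q0 ea (divr_gt0 e0 C0).
have tail m n : (N <= m)%N -> (m <= n)%N -> qnorm (psum a n - psum a m) < e.
  move=> Nm mn; pose b j := if (m <= j)%N then a j else 0.
  have -> : psum a n - psum a m = psum b n.
    apply/eqP; rewrite subr_eq; apply/eqP.
    rewrite /psum -!(big_mkord xpredT (fun j => _ j *: g j)).
    rewrite (big_cat_nat (leq0n _) mn)/=.
    rewrite [X in _ = X + _](big_cat_nat (leq0n _) mn)/=.
    rewrite [X in _ = X + _ + _]big1_seq ?add0r; last first.
      move=> j /=; rewrite mem_index_iota leq0n /b /= => jm.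
      by rewrite leqNgt jm scale0r.
    rewrite addrC; congr (_ + _); rewrite !big_seq; apply: eq_bigr => j.
    by rewrite mem_index_iota /b => /andP[->].
  apply: le_lt_trans (upper _ _) _; rewrite mulrC -ltr_pdivlMr//.
  have := NP m n Nm; congr (_ < _); congr lsum; apply/funext => j.
  by rewrite /b; case: ifP; rewrite ?modulus0.
exists N => m n Nm Nn; have [mn|nm] := leqP m n.
  by rewrite qnormB tail.
by rewrite tail// ltnW.
Qed.

Lemma ell_sum_lin z a b : ell q a -> ell q b ->
  S (fun n => z * a n + b n) = z *: S a + S b.
Proof.
move=> /ell_sumP Sa /ell_sumP Sb.
have Sab : qlim_to (psum (fun n => z * a n + b n)) (z *: S a + S b).
  have := qlim_lin z Sa Sb; congr qlim_to; apply/funext => n.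
  rewrite /psum scaler_sumr -big_split; apply: eq_bigr => j _.
  by rewrite scalerDl scalerA.
apply: (qlim_unique _ Sab); apply: (@xgetPex _ 0 [set v | qlim_to (psum _) v]).
by exists (z *: S a + S b).
Qed.

(** The quasi-norm need not be continuous, so passing to the limit costs the
    constant of the quasi-triangle inequality, here and in the lower bound. *)
Lemma ell_sum_upper : exists D, forall a, ell q a ->
  qnorm (S a) <= D * ell_norm q a.
Proof.
have [K K1 tri] := quasi_triangle Y.
have K0 : 0 < K by apply: lt_le_trans K1.
exists (K * C) => a ea; apply/ler_addgt0Pl => e e0.
have [N /(_ N (leqnn N)) NP] := ell_sumP ea (divr_gt0 e0 K0).
rewrite -[S a](subrK (psum a N)).
apply: le_trans (tri _ _) _; rewrite mulrDr lerD//.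
  by move: NP; rewrite ltr_pdivlMr// mulrC => /ltW.
rewrite -mulrA ler_pM2l//; apply: le_trans (upper _ _) _.
by rewrite ler_pM2l//; exact: lsum_le_ell_norm.
Qed.

Lemma ell_sum_lower : exists2 d, 0 < d & forall a, ell q a ->
  d * ell_norm q a <= qnorm (T (S a)).
Proof.
have [B B0 TB] := bounded_operator_gt0 hT.
have [K K1 tri] := quasi_triangle X.
have K0 : 0 < K by apply: lt_le_trans K1.
have cK : 0 < c / K by exact: divr_gt0.
exists (c / K) => // a ea; rewrite mulrC -ler_pdivlMr//.
apply: (ell_norm_le q0 ea) => n; rewrite ler_pdivlMr//.
apply/ler_addgt0Pl => e e0.
have [N NP] := ell_sumP ea (divr_gt0 e0 B0).
pose m := maxn n N.
apply: (@le_trans _ _ (c / K * lsum_ a m)).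
  rewrite mulrC ler_pM2l//.
  apply: (lsum_widen q0 (t := fun j => modulus (a j))); last exact: leq_maxl.
  by move=> j; exact: modulus_ge0.
rewrite mulrAC ler_pdivrMr//; apply: le_trans (lower _ _) _.
rewrite -[T (psum a m)](subrK (T (S a))) mulrC.
apply: le_trans (tri _ _) _; rewrite ler_pM2l// lerD2r -linearB.
apply: le_trans (TB _) _; rewrite mulrC -ler_pdivlMr// qnormB.
by apply/ltW/NP; exact: leq_maxr.
Qed.

(** The two bounds transfer across the bounded operator [T]: the upper one
    forward to [X], the lower one back to [Y]. *)
Lemma contains_ell_of_equivalence : contains_ell Y q /\ contains_ell X q.
Proof.
have [B B0 TB] := bounded_operator_gt0 hT.
have [D SD] := ell_sum_upper; have [d d0 Sd] := ell_sum_lower.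
split.
  exists S; split; first by move=> z a b; exact: ell_sum_lin.
  exists (d / B), D; split=> [|a ea]; first exact: divr_gt0.
  rewrite SD// andbT mulrAC ler_pdivrMr// mulrC.
  by rewrite [leRHS]mulrC (le_trans _ (TB _))// [leLHS]mulrC Sd.
exists (T \o S); split.
  by move=> z a b ea eb; rewrite /= ell_sum_lin// linearP.
exists d, (B * D); split=> // a ea; rewrite Sd//=.
by apply: le_trans (TB _) _; rewrite -mulrA ler_pM2l// SD.
Qed.

End EllEmbedding.

(** * Estimates on disjoint blocks and their perturbations *)

Section Blocks.
Context {R : realType} {k : scalar_kind} {V : quasiBanachType R k}.
Context {I : countType} (x : I -> V) (q : \bar R).
Hypotheses (q0 : (0 < q)%E) (hx : unconditional_basis x).
Implicit Types (a : nat -> scalar_field R k) (g : nat -> V).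

Lemma disjointly_supported_scaled g a n :
  trivIset setT (fun j => bsupport x (g j)) ->
  disjointly_supported x (fun j : 'I_n => a j *: g j).
Proof.
move=> gdisj i j _ _ [l [/(bsupportZ hx) li /(bsupportZ hx) lj]].
by apply/val_inj/(gdisj _ _ Logic.I Logic.I); exists l.
Qed.

Lemma upper_estimate_blocks g K : upper_estimate x q ->
  trivIset setT (fun j => bsupport x (g j)) ->
  0 < K -> (forall n, qnorm (g n) <= K) ->
  exists2 C, 0 < C & forall a n, qnorm (\sum_(j < n) a j *: g j) <=
    C * lsum q (fun j : 'I_n => modulus (a j)).
Proof.
move=> [C CP] gdisj K0 gK; have C0 : 0 < `|C| + 1 by rewrite ltr_wpDl.
exists ((`|C| + 1) * K) => [|a n]; first exact: mulr_gt0.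
apply: le_trans (CP _ _ (@disjointly_supported_scaled g a n gdisj)) _.
apply: (@le_trans _ _ ((`|C| + 1) * lsum q (fun j : 'I_n => qnorm (a j *: g j)))).
  by rewrite ler_wpM2r ?lsum_ge0// (le_trans (ler_norm _))// lerDl.
rewrite -mulrA ler_pM2l// -lsumZ ?(ltW K0)//; last by move=> j; exact: modulus_ge0.
apply: ler_lsum => // j; rewrite qnorm_ge0 qnormZ mulrC.
by rewrite ler_wpM2r// modulus_ge0.
Qed.

(** The constant is uniform in the blocks, because the admissible perturbation
    errors depend on it and have to be fixed before the blocks are chosen. *)
Lemma lower_estimate_blocks d : lower_estimate x q -> 0 < d ->
  exists2 c, 0 < c & forall g,
    trivIset setT (fun j => bsupport x (g j)) ->
    (forall n, d <= qnorm (g n)) -> forall a n,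
    c * lsum q (fun j : 'I_n => modulus (a j)) <= qnorm (\sum_(j < n) a j *: g j).
Proof.
move=> [C CP] d0; have C0 : 0 < `|C| + 1 by rewrite ltr_wpDl.
exists (d / (`|C| + 1)) => [|g gdisj dg a n]; first exact: divr_gt0.
rewrite mulrAC ler_pdivrMr// -lsumZ ?(ltW d0)//; last first.
  by move=> j; exact: modulus_ge0.
apply: (@le_trans _ _ (C * qnorm (\sum_(j < n) a j *: g j))).
  apply: le_trans (CP _ _ (@disjointly_supported_scaled g a n gdisj)).
  apply: ler_lsum => // j; rewrite mulr_ge0 ?(ltW d0) ?modulus_ge0//= qnormZ mulrC.
  by rewrite ler_wpM2l// modulus_ge0.
by rewrite mulrC ler_wpM2l ?qnorm_ge0// (le_trans (ler_norm _))// lerDl.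
Qed.

End Blocks.

Section Perturbation.
Context {R : realType} {k : scalar_kind} {V : quasiBanachType R k}.

(** In a quasi-normed space the constant accumulates along a sum; it is put on
    the late terms, which can be made small. *)
Lemma qnorm_sum K (s : nat -> V) n :
  (forall u v : V, qnorm (u + v) <= K * (qnorm u + qnorm v)) -> 1 <= K ->
  qnorm (\sum_(j < n) s j) <= \sum_(j < n) K ^+ j.+1 * qnorm (s j).
Proof.
move=> tri K1; have K0 : 0 < K by apply: lt_le_trans K1.
elim: n s => [|n ih] s; first by rewrite !big_ord0 qnorm0.
rewrite !big_ord_recl; apply: le_trans (tri _ _) _.
rewrite mulrDr expr1 lerD2l.
apply: (@le_trans _ _ (K * \sum_(j < n) K ^+ j.+1 * qnorm (s j.+1))).
  by rewrite ler_pM2l//; exact: (ih (fun j => s j.+1)).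
by rewrite mulr_sumr; apply: ler_sum => j _; rewrite mulrA -exprS.
Qed.

(** Each coefficient is at most the [ell q] norm, so the total error is at most
    the weighted sum of the individual errors times that norm. The factor
    [K ^+ n.+1] in the error allowed at [n] cancels the weight of [qnorm_sum],
    the factor [2 ^+ n.+1] makes the series summable, and the remaining constant
    makes the total half of [c / K], the lower bound that survives the
    quasi-triangle inequality. *)
Lemma lower_estimate_perturb K (s t : nat -> V) (q : \bar R) c :
  (0 < q)%E ->
  (forall u v : V, qnorm (u + v) <= K * (qnorm u + qnorm v)) -> 1 <= K ->
  0 < c ->
  (forall (a : nat -> scalar_field R k) n,
    c * lsum q (fun j : 'I_n => modulus (a j)) <=
    qnorm (\sum_(j < n) a j *: s j)) ->
  (forall n, qnorm (t n - s n) < c / (2 * K) / (2 * K) ^+ n.+1) ->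
  forall (a : nat -> scalar_field R k) n,
    c / (2 * K) * lsum q (fun j : 'I_n => modulus (a j)) <=
    qnorm (\sum_(j < n) a j *: t j).
Proof.
move=> q0 tri K1 c0 sc ts a n; have K0 : 0 < K by apply: lt_le_trans K1.
set L := lsum _ _.
have L0 : 0 <= L by exact: lsum_ge0.
have : qnorm (\sum_(j < n) a j *: (s j - t j)) <= c / (2 * K) * L.
  apply: le_trans (qnorm_sum (fun j => a j *: (s j - t j)) n tri K1) _.
  have geo : \sum_(j < n) (2^-1 : R) ^+ j.+1 <= 1.
    suff -> : \sum_(j < n) (2^-1 : R) ^+ j.+1 = 1 - 2^-1 ^+ n.
      by rewrite gerBl exprn_ge0// invr_ge0.
    elim: (n) => [|m ih]; first by rewrite big_ord0 expr0 subrr.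
    by rewrite big_ord_recr /= ih exprS; field.
  apply: (@le_trans _ _ (c / (2 * K) * L * \sum_(j < n) 2^-1 ^+ j.+1)); last first.
    by rewrite ler_piMr// mulr_ge0// divr_ge0 ?mulr_ge0// ltW.
  rewrite mulr_sumr; apply: ler_sum => j _; rewrite qnormZ.
  have aL : modulus (a j) <= L.
    apply: (@lsum_ge _ _ q0 n (fun j : 'I_n => modulus (a j)) j) => i.
    exact: modulus_ge0.
  have := ts j; rewrite qnormB => /ltW tj.
  apply: (@le_trans _ _ (K ^+ j.+1 * (L * (c / (2 * K) / (2 * K) ^+ j.+1)))).
    by rewrite ler_wpM2l ?exprn_ge0 ?(ltW K0)// ler_pM ?modulus_ge0 ?qnorm_ge0.
  rewrite le_eqVlt; apply/orP; left; apply/eqP.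
  rewrite exprMn exprVn; field.
  by rewrite gt_eqF// expf_neq0 ?pnatr_eq0// gt_eqF// exprn_gt0.
move=> h.
have := tri (\sum_(j < n) a j *: t j) (\sum_(j < n) a j *: (s j - t j)).
rewrite -big_split /=.
under eq_bigr do rewrite -scalerDr addrC subrK.
move=> /(le_trans (sc a n)); rewrite -/L [c * L]mulrC [leRHS]mulrC.
rewrite -ler_pdivrMr// => h'.
have E : L * c / K = 2 * (c / (2 * K) * L) by field; rewrite gt_eqF.
rewrite E in h'; lra.
Qed.

End Perturbation.

(** * Conclusion *)

(** Dependent choice in which each term must be compatible with all the earlier
    ones; the finite history is the state of the recursion. *)
Lemma dependent_sequence (A : choiceType) (good : A -> Prop)
    (ok : nat -> A -> Prop) (compat : A -> A -> Prop) :
  (forall s : seq A, (forall p, p \in s -> good p) -> exists p,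
     [/\ good p, ok (size s) p & forall r, r \in s -> compat r p]) ->
  exists u : nat -> A, forall n,
     [/\ good (u n), ok n (u n) & forall m, (m < n)%N -> compat (u m) (u n)].
Proof.
move=> step.
have /choice[f fP] : forall s, exists p, (forall r, r \in s -> good r) ->
    [/\ good p, ok (size s) p & forall r, r \in s -> compat r p].
  move=> s; have [gs|ngs] := pselect (forall r, r \in s -> good r).
    by have [p pP] := step s gs; exists p.
  by have [|p _] := step [::] _ => //; exists p.
pose h := fix h n := if n is m.+1 then f (h m) :: h m else [::].
have sh n : size (h n) = n by elim: n => //= n ->.
have gh n p : p \in h n -> good p.
  elim: n p => //= n ih p; rewrite inE => /orP[/eqP ->|/ih//].
  by have [] := fP _ ih.
have mem m n : (m < n)%N -> f (h m) \in h n.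
  elim: n => // n ih; rewrite ltnS leq_eqVlt inE => /orP[/eqP ->|/ih ->].
    by rewrite eqxx.
  by rewrite orbT.
exists (f \o h) => n; have [h1 h2 h3] := fP _ (@gh n).
by split=> //=; [rewrite -{1}(sh n)|move=> m /mem; exact: h3].
Qed.

Theorem corollary2p7 (R : realType) (k : scalar_kind)
    (X Y : quasiBanachType R k) (I J : countType)
    (x : I -> X) (y : J -> Y)
    (hx : unconditional_basis x) (hy : unconditional_basis y)
    (hxy : lattice_estimate_disjoint x y)
    (T : {linear Y -> X}) (hT : bounded_operator T) :
  compact_operator T.
Proof.
apply: contrapT => Tnc; have [q q0 [lowx upy noell]] := hxy.
suff [inY inX] : contains_ell Y q /\ contains_ell X q by case: noell; exact.
have [K [d [K0 d0 blocks]]] := almost_preserved_blocks hx hy hT Tnc.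
have [KX KX1 tri] := quasi_triangle X.
have KX0 : 0 < KX by apply: lt_le_trans KX1.
have [c c0 lowc] := lower_estimate_blocks q0 hx lowx d0.
pose eps n := c / (2 * KX) / (2 * KX) ^+ n.+1.
have eps0 n : 0 < eps n by rewrite !divr_gt0 ?exprn_gt0 ?mulr_gt0.
have [|u uP] := @dependent_sequence (Y * X)%type
  (fun p => finite_set (bsupport y p.1) /\ finite_set (bsupport x p.2))
  (fun n p => [/\ qnorm p.1 <= K, d <= qnorm p.2 &
                  qnorm (T p.1 - p.2) < eps n])
  (fun p r => bsupport y p.1 `&` bsupport y r.1 = set0 /\
              bsupport x p.2 `&` bsupport x r.2 = set0) _; last first.
  pose g n := (u n).1; pose h n := (u n).2.
  have gdisj : trivIset setT (fun n => bsupport y (g n)).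
    apply: ltn_trivIset => n m mn; have [_ _ /(_ m mn)[e _]] := uP n.
    exact: e.
  have hdisj : trivIset setT (fun n => bsupport x (h n)).
    apply: ltn_trivIset => n m mn; have [_ _ /(_ m mn)[_ e]] := uP n.
    exact: e.
  have gK n : qnorm (g n) <= K by have [_ []] := uP n.
  have dh n : d <= qnorm (h n) by have [_ []] := uP n.
  have Tgh n : qnorm (T (g n) - h n) < eps n by have [_ []] := uP n.
  have [C C0 upC] := upper_estimate_blocks q0 hy upy gdisj K0 gK.
  have c10 : 0 < c / (2 * KX) by rewrite divr_gt0// mulr_gt0.
  apply: (contains_ell_of_equivalence q0 hT C0 c10 upC) => a n.
  rewrite linear_sum; under eq_bigr do rewrite linearZ.
  exact: (lower_estimate_perturb q0 tri KX1 c0 (lowc h hdisj dh) Tgh).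
move=> s sfin.
have [||g [h [fg gs gK [fh hs dh Tgh]]]] := blocks
  (\bigcup_(p in [set` s]) bsupport y p.1)
  (\bigcup_(p in [set` s]) bsupport x p.2) (eps (size s)) _ _ (eps0 _).
- by apply: bigcup_finite => // p /sfin[].
- by apply: bigcup_finite => // p /sfin[].
exists (g, h); split=> // p ps; split; apply/seteqP; split=> // i [pi gi].
  by suff: set0 i by []; rewrite -gs; split=> //; exists p.
by suff: set0 i by []; rewrite -hs; split=> //; exists p.
Qed.
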